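(* Let $\mathfrak{H}$ be an infinite-dimensional complex Hilbert space. For two bounded linear operators $X, Y \in B(\mathfrak{H})$, the triangle equality $|X+Y| = |X| + |Y|$ holds if and only if there exists a partial isometry $U \in B(\mathfrak{H})$ such that $X = U|X|$ and $Y = U|Y|$.
   Context: $B(\mathfrak{H})$ denotes the set of all bounded linear operators on $\mathfrak{H}$. For $X \in B(\mathfrak{H})$, the absolute value is $|X| = (X^{*}X)^{1/2}$, the unique positive square root of $X^{*}X$. An operator $U \in B(\mathfrak{H})$ is called a partial isometry if $U^{*}U$ is an orthogonal projection. *)

(* Defs.v *)
From HB Require Import structures.
From mathcomp Require Import all_boot all_order all_algebra.
From mathcomp Require Import all_classical all_reals all_analysis.
From mathcomp Require Import complex.
Set Implicit Arguments.
Unset Strict Implicit.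
Unset Printing Implicit Defensive.
Import Order.TTheory GRing.Theory Num.Theory.
Import numFieldNormedType.Exports.
Local Open Scope classical_set_scope.
Local Open Scope ring_scope.

(* The norm takes its values in [R[i]], so the squared norm is literally
   <u, u>.  The form is linear in its first argument and conjugate-linear in
   the second. *)
HB.mixin Record CompleteNormedModule_isHilbert (R : realType) (H : Type)
    of CompleteNormedModule R[i] H := {
  hdot : {dot H for (@Num.conj R[i])} ;
  hdot_norm : forall u : H, `|u| ^+ 2 = hdot u u }.

#[short(type="hilbertType")]
HB.structure Definition Hilbert (R : realType) :=
  { H of CompleteNormedModule_isHilbert R H & CompleteNormedModule R[i] H }.

Notation "'[ u , v ]" := (hdot u v) : ring_scope.

Section Operators.
Context {R : realType} {H : hilbertType R}.
Implicit Types X Y A P T U : H -> H.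

(* For a linear map, boundedness near 0 is equivalent to an operator-norm
   bound, see [linear_boundedP]. *)
Definition bounded_operator : set (H -> H) :=
  [set X | linear X /\ bounded_near X (nbhs (0 : H))].

(* [xget 0 S] is an element of [S] when there is one: the adjoint of a bounded
   operator, and the positive square root of a positive one, exist and are
   unique, so the default value 0 is never used for them. *)
Definition adjoint X : H -> H :=
  xget 0 [set Y | bounded_operator Y /\ forall u v, '[X u, v] = '[u, Y v]].

Definition positive_operator : set (H -> H) :=
  [set A | bounded_operator A /\ forall u, 0 <= '[A u, u]].

Definition op_sqrt T : H -> H :=
  xget 0 [set A | positive_operator A /\ A \o A = T].

Definition op_abs X : H -> H := op_sqrt (adjoint X \o X).

Definition orthogonal_projection P : Prop :=
  [/\ bounded_operator P, P \o P = P & adjoint P = P].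

Definition partial_isometry U : Prop :=
  bounded_operator U /\ orthogonal_projection (adjoint U \o U).

End Operators.

Definition infinite_dimensional (K : fieldType) (V : lmodType K) : Prop :=
  ~ exists s : seq V, forall v : V,
      exists c : 'I_(size s) -> K, v = \sum_(i < size s) c i *: s`_i.

(* Main.v *)
(* Write A = |X|, B = |Y|, G = A + B and let U be the partial isometry of the
   polar decomposition X + Y = U G.  Put F = A - U^*X = U^*Y - B.  Expanding
   |X + Y|^2 = G^2 shows that G F is skew-adjoint, and |U^*X u| <= |X u| = |A u|
   gives |F u|^2 <= 2 Re <A F u, u>.  Since 0 <= A <= G these two facts force
   F = 0 ([skew_form_eq0]): a vector on which F is almost extremal for the norm
   of G nearly satisfies F^2 u = -m^2 u, and then the second fact, applied to
   F u and to F^2 u, makes m |F u| small.  So U^*X = A and U^*Y = B, and as U^*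
   does not decrease the norm of X u, X = U A.  The uniqueness of the positive
   square root is the case F = A - B of the same lemma.

   All estimates use the real inner product Re <u, v>. *)
From HB Require Import structures.
Require Import Defs.
From mathcomp Require Import all_boot all_order all_algebra.
From mathcomp Require Import all_classical all_reals all_analysis.
From mathcomp Require Import complex.
From mathcomp Require Import ring lra.
Import Order.TTheory GRing.Theory Num.Theory.
Import numFieldNormedType.Exports.
Local Open Scope classical_set_scope.
Local Open Scope ring_scope.

(** * Positive forms *)

Section PositiveForms.
Context {R : realType} {V : lmodType R[i]}.
Implicit Types (a g : V -> V -> R) (u v w : V).

(** Only real scalars are taken out, so that on a complex space both [rdot] and, for a positive
    operator [A], the form [rdot (A u) v] are instances; degenerate forms are allowed. *)
Definition positive_form a : Prop :=
  [/\ forall u v, a u v = a v u,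
      forall u v w, a (u + v) w = a u w + a v w,
      forall (r : R) u v, a (r%:C%C *: u) v = r * a u v
    & forall u, 0 <= a u u].

Section Theory.
Variable a : V -> V -> R.
Hypothesis pa : positive_form a.

Let aC u v : a u v = a v u. Proof. by case: pa. Qed.
Let a_ge0 u : 0 <= a u u. Proof. by case: pa. Qed.

Lemma pformDl u v w : a (u + v) w = a u w + a v w. Proof. by case: pa. Qed.

Lemma pformDr u v w : a w (u + v) = a w u + a w v.
Proof. by rewrite aC pformDl !(aC w). Qed.

Lemma pformZl (r : R) u v : a (r%:C%C *: u) v = r * a u v.
Proof. by case: pa. Qed.

Lemma pformZr (r : R) u v : a v (r%:C%C *: u) = r * a v u.
Proof. by rewrite aC pformZl (aC v). Qed.

Lemma pform_CauchySchwarz u v : a u v ^+ 2 <= a u u * a v v.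
Proof.
have expand (r s : R) : 0 <= r ^+ 2 * a u u + 2 * r * s * a u v + s ^+ 2 * a v v.
  have := a_ge0 (r%:C%C *: u + s%:C%C *: v).
  rewrite !(pformDl, pformDr, pformZl, pformZr) (aC v u).
  by congr (_ <= _); ring.
(* These coefficients turn the quadratic form into [a v v], respectively [a u u], times the
   difference to be shown nonnegative. The coefficients 1 and -1 settle the case where both diagonal
   values vanish. *)
have hv := expand (a v v) (- a u v).
have hu := expand (- a u v) (a u u).
have h1 := expand 1 1; have h2 := expand 1 (-1).
have := a_ge0 u; have := a_ge0 v.
rewrite !le0r => /orP[/eqP v0|v0] /orP[/eqP u0|u0]; nra.
Qed.

End Theory.

(* Writing P s for [forall u, g (F u) (F u) <= s * g u u], the hypotheses give
   P k for k = 4 c^2 and P (k / m) -> P (k / (m + 1)); the latter comes from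
   s n(Fu) + n(F^2 u) <= 2 a(s u + F^2 u, F u) and Cauchy-Schwarz. *)
Lemma skew_form_eq0 a g (n : V -> V -> R) (F : V -> V) (c : R) :
  positive_form a -> positive_form g -> positive_form n ->
  (forall u, a u u <= g u u) -> 0 < c -> (forall u, g u u <= c * n u u) ->
  (forall u v, g (F u) v = - g u (F v)) ->
  (forall u, n (F u) (F u) <= 2 * a (F u) u) ->
  forall u, n (F u) (F u) = 0.
Proof.
move=> pa pg pn ag c0 gn skew nF.
have a_ge0 u : 0 <= a u u by case: pa.
have g_ge0 u : 0 <= g u u by case: pg.
have n_ge0 u : 0 <= n u u by case: pn.
have aC u v : a u v = a v u by case: pa.
have gC u v : g u v = g v u by case: pg.
have CS u v : a u v ^+ 2 <= g u u * g v v.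
  apply: le_trans (pform_CauchySchwarz _ pa u v) _.
  by apply: ler_pM.
(* The constant of the base case: g(Fu,Fu) <= c n(Fu,Fu) <= 2c a(Fu,u), which is squared and
   combined with [CS], after which one factor g(Fu,Fu) cancels. *)
pose k := 4 * c ^+ 2.
have k0 : 0 < k by rewrite /k; nra.
have base u : g (F u) (F u) <= k * g u u.
  have := nF u; have := gn (F u); have := CS (F u) u.
  have := g_ge0 (F u); have := g_ge0 u; have := n_ge0 (F u).
  rewrite /k; move: (g u u) (g (F u) (F u)) (n _ _) (a _ _) => p t m x.
  move=> m0 p0 t0 h1 h2 h3.
  have h4 : m ^+ 2 <= 4 * x ^+ 2 by nra.
  have h5 : t ^+ 2 <= c ^+ 2 * m ^+ 2 by nra.
  have h6 : t ^+ 2 <= 4 * c ^+ 2 * (t * p) by nra.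
  move: t0; rewrite le0r => /orP[/eqP ->|t0]; first nra.
  by rewrite -(ler_pM2l t0); nra.
have step (s : R) : 0 < s -> (forall u, g (F u) (F u) <= s * g u u) ->
    forall u, (s + k) * g (F u) (F u) <= k * s * g u u.
  move=> s0 Ps u.
  (* By skewness and the bound at [F u], g(w,w) <= s (s g(u,u) - g(Fu,Fu)). With t = g(Fu,Fu) and p
     = g(u,u) this leads to (s t)^2 <= k s (s p - t) t, and s t cancels. *)
  pose w := s%:C%C *: u + F (F u).
  have e1 : g w w = s ^+ 2 * g u u - 2 * s * g (F u) (F u)
              + g (F (F u)) (F (F u)).
    rewrite /w !(pformDl, pformDr, pformZl, pformZr) //.
    by rewrite skew (gC u (F (F u))) skew; ring.
  have e2 : a w (F u) = s * a (F u) u + a (F (F u)) (F u).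
    by rewrite /w !(pformDl, pformZl) // (aC u).
  have := CS w (F u); rewrite e1 e2.
  have := nF u; have := nF (F u); have := gn (F u); have := Ps u.
  have := Ps (F u); have := g_ge0 u; have := g_ge0 (F u).
  have := n_ge0 (F (F u)); have := n_ge0 (F u).
  move: (g u u) (g (F u) (F u)) (g (F (F u)) (F (F u))) (n (F u) (F u))
    (n (F (F u)) (F (F u))) (a (F u) u) (a (F (F u)) (F u)) => p t r m m' x y.
  move=> m0 m'0 t0 p0 h1 h2 h3 h4 h5 h6.
  have h7 : s * m <= 2 * (s * x + y) by nra.
  have h8 : s * t <= c * (s * m) by nra.
  have h9 : s * t <= 2 * c * (s * x + y) by nra.
  have h10 : (s * t) ^+ 2 <= (2 * c) ^+ 2 * (s * x + y) ^+ 2.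
    by rewrite -exprMn lerXn2r ?nnegrE //; nra.
  have h11 : (s * x + y) ^+ 2 <= s * (s * p - t) * t.
    apply: le_trans h6 _; apply: ler_wpM2r => //; nra.
  have h12 : (s * t) ^+ 2 <= k * (s * (s * p - t) * t).
    by apply: le_trans h10 _; rewrite /k; nra.
  move: t0; rewrite le0r => /orP[/eqP ->|t0].
    by rewrite mulr0 !mulr_ge0 // ltW.
  have st : 0 < s * t by nra.
  by rewrite -(ler_pM2l st); nra.
have iter m u : m.+1%:R * g (F u) (F u) <= k * g u u.
  elim: m u => [|m IH] u; first by rewrite mul1r.
  have m0 : 0 < m.+1%:R :> R by [].
  have s0 : 0 < k / m.+1%:R by rewrite divr_gt0.
  have H v : g (F v) (F v) <= k / m.+1%:R * g v v.
    by rewrite mulrAC ler_pdivlMr // mulrC.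
  have := step _ s0 H u; rewrite -[m.+2]addn1 natrD.
  move: s0 m0 => {H IH}; move: (m.+1%:R : R) => x s0 x0.
  move: (g (F u) (F u)) (g u u) => t p.
  rewrite (_ : _ * t = k / x * ((x + 1) * t)); last by field; rewrite gt_eqF.
  rewrite (_ : _ * p = k / x * (k * p)); last by ring.
  by rewrite ler_pM2l.
have g0 u : g (F u) (F u) = 0.
  apply/eqP; rewrite eq_le g_ge0 andbT leNgt; apply/negP => t0.
  have [m hm] : exists m : nat, k * g u u / g (F u) (F u) < m%:R.
    by exists (Num.truncn (k * g u u / g (F u) (F u))).+1; apply: truncnS_gt.
  have := iter m u; rewrite leNgt => /negP; apply.
  rewrite -ltr_pdivrMr //; apply: lt_le_trans hm _.
  by rewrite ler_nat.
(* [g] may be degenerate, so [g0] alone does not give [F u = 0]; the vanishing passes to [n] through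
   [a (F u) u]. *)
move=> u; apply/eqP; rewrite eq_le n_ge0 andbT.
apply: le_trans (nF u) _.
have := CS (F u) u; rewrite g0 mul0r => h.
have -> : a (F u) u = 0 by apply/eqP; rewrite -sqrf_eq0 eq_le h sqr_ge0.
by rewrite mulr0.
Qed.
End PositiveForms.

(** * The real inner product *)

Section RealPart.
Context {R : realType} {H : hilbertType R}.
Implicit Types (u v w : H).

Definition rdot u v : R := complex.Re '[u, v].
Definition rnorm u : R := Num.sqrt (rdot u u).

Lemma hdotC u v : '[u, v] = conjc '[v, u].
Proof. by rewrite hermC expr0 mul1r. Qed.

Lemma ReD (x y : R[i]) : complex.Re (x + y) = complex.Re x + complex.Re y.
Proof. by case: x; case: y. Qed.

Lemma hdot_ge0 u : 0 <= '[u, u].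
Proof. by rewrite -hdot_norm exprn_ge0. Qed.

Lemma hdot_rdot u : '[u, u] = (rdot u u)%:C%C.
Proof.
have := hdot_ge0 u; rewrite lecE /rdot; case: '[u, u] => x y /=.
by case/andP => /eqP -> _.
Qed.

Lemma rdotC u v : rdot u v = rdot v u.
Proof. by rewrite /rdot hdotC; case: '[v, u]. Qed.

Lemma rdotDl u v w : rdot (u + v) w = rdot u w + rdot v w.
Proof. by rewrite /rdot linearDl ReD. Qed.

Lemma rdotZl (r : R) u v : rdot (r%:C%C *: u) v = r * rdot u v.
Proof.
rewrite /rdot linearZl_LR /=; case: '[u, v] => x y /=.
by rewrite mul0r subr0.
Qed.

Lemma rdot_ge0 u : 0 <= rdot u u.
Proof. by have := hdot_ge0 u; rewrite lecE => /andP[]. Qed.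

Lemma positive_rdot : positive_form rdot.
Proof.
split; [exact: rdotC|exact: rdotDl|exact: rdotZl|exact: rdot_ge0].
Qed.

Lemma rdotDr u v w : rdot w (u + v) = rdot w u + rdot w v.
Proof. by rewrite rdotC rdotDl !(rdotC w). Qed.
Lemma rdotNl u w : rdot (- u) w = - rdot u w.
Proof. by apply/eqP; rewrite -addr_eq0 -rdotDl addNr /rdot linear0l. Qed.
Lemma rdotNr u w : rdot w (- u) = - rdot w u.
Proof. by rewrite rdotC rdotNl rdotC. Qed.
Lemma rdotZr (r : R) u v : rdot v (r%:C%C *: u) = r * rdot v u.
Proof. by rewrite rdotC rdotZl rdotC. Qed.

Definition rdotE := (rdotDl, rdotDr, rdotNl, rdotNr, rdotZl, rdotZr).

Lemma rdot_eq0 u : rdot u u = 0 -> u = 0.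
Proof.
move=> u0; apply/eqP; rewrite -normr_eq0 -sqrf_eq0 hdot_norm hdot_rdot u0.
by rewrite rmorph0.
Qed.

Lemma rdot_imZl u v : rdot ('i%C *: u) v = - complex.Im '[u, v].
Proof. by rewrite /rdot linearZl_LR mulrC ReiNIm. Qed.

(** Multiplication by i exchanges real and imaginary parts up to sign, so the real inner product
    determines the complex one. *)
Lemma hdot_eq_rdot (u v u' v' : H) :
  rdot u v = rdot u' v' -> rdot ('i%C *: u) v = rdot ('i%C *: u') v' ->
  '[u, v] = '[u', v'].
Proof.
rewrite !rdot_imZl /rdot => h /oppr_inj h'.
by apply/eqP; rewrite eq_complex h h' !eqxx.
Qed.

Lemma rdot_inj u v : (forall w, rdot u w = rdot v w) -> u = v.
Proof.
move=> uv; apply/eqP; rewrite -subr_eq0; apply/eqP/rdot_eq0.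
by rewrite rdotDl rdotNl uv subrr.
Qed.

Lemma rnorm_ge0 u : 0 <= rnorm u. Proof. exact: sqrtr_ge0. Qed.
Lemma rnorm_sqr u : rnorm u ^+ 2 = rdot u u.
Proof. by rewrite sqr_sqrtr // rdot_ge0. Qed.
Lemma norm_rnorm u : `|u| = (rnorm u)%:C%C.
Proof.
have h : 0 <= (rnorm u)%:C%C :> R[i] by rewrite lecR rnorm_ge0.
by apply/eqP; rewrite -(@eqrXn2 _ 2) // hdot_norm hdot_rdot -rmorphXn rnorm_sqr.
Qed.

Lemma ler_rdot u v : rdot u v <= rnorm u * rnorm v.
Proof.
have h := pform_CauchySchwarz _ positive_rdot u v.
apply: le_trans (ler_norm _) _.
rewrite -[leLHS]sqrtr_sqr /rnorm -sqrtrM ?rdot_ge0 //.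
by rewrite ler_wsqrtr.
Qed.

Lemma ler_rnormD u v : rnorm (u + v) <= rnorm u + rnorm v.
Proof. by have := ler_normD u v; rewrite !norm_rnorm -rmorphD lecR. Qed.

Lemma rnormN u : rnorm (- u) = rnorm u.
Proof. by rewrite /rnorm !rdotE opprK. Qed.

Lemma rnormZ (r : R) u : 0 <= r -> rnorm (r%:C%C *: u) = r * rnorm u.
Proof.
move=> r0; rewrite /rnorm !rdotE mulrA -expr2 sqrtrM ?sqr_ge0 //.
by rewrite sqrtr_sqr ger0_norm.
Qed.

(** Distances in [H] are compared with elements of [R[i]]; a positive one is a positive real, so
    complex and real epsilons define the same convergence. *)
Lemma cvg_rnorm_sub (f : nat -> H) (l : H) :
  f @ \oo --> l <-> rnorm (f n - l) @[n --> \oo] --> 0.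
Proof.
split=> [/cvgrPdist_lt h|/cvgrPdist_lt h]; apply/cvgrPdist_lt.
  move=> e e0; have := h e%:C%C; rewrite ltcR => /(_ e0).
  apply: filterS => n; rewrite norm_rnorm ltcR sub0r normrN.
  by rewrite ger0_norm ?rnorm_ge0 // -rnormN opprB.
move=> [e e']; rewrite ltcE /= => /andP[/eqP -> e0].
apply: filterS (h e e0) => n; rewrite norm_rnorm sub0r normrN.
by rewrite ger0_norm ?rnorm_ge0 // ltcR -rnormN opprB.
Qed.

Lemma cvg_rdot (f : nat -> H) (l z : H) :
  f @ \oo --> l -> rdot (f n) z @[n --> \oo] --> rdot l z.
Proof.
move=> /cvg_rnorm_sub fl; apply/subr_cvg0.
have : - (rnorm (f n - l) * rnorm z) @[n --> \oo] --> - (0 * rnorm z).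
  by apply: cvgN; apply: cvgMr_tmp.
have : rnorm (f n - l) * rnorm z @[n --> \oo] --> 0 * rnorm z by exact: cvgMr_tmp.
rewrite mul0r oppr0 => h1 h2; apply: squeeze_cvgr h2 h1.
apply: nearW => n; rewrite -rdotNl -rdotDl lerNl -rdotNl.
by rewrite ler_rdot -{1}(rnormN (f n - l)) ler_rdot.
Qed.

Lemma rnorm_complete (f : nat -> H) :
  (forall e : R, 0 < e -> exists N,
     forall m n, (N <= m)%N -> (N <= n)%N -> rnorm (f m - f n) < e) ->
  exists l : H, f @ \oo --> l.
Proof.
move=> fC.
have Cgt0 (e : R[i]) : 0 < e -> exists2 r : R, 0 < r & e = r%:C%C.
  case: e => r s; rewrite ltcE /= => /andP[/eqP -> r0].
  by exists r.
have : cauchy (f @ \oo).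
  apply/cauchy_exP => _ /Cgt0[e e0 ->].
  have [N hN] := fC e e0; exists (f N); exists N => // n /= Nn.
  by rewrite -ball_normE /= norm_rnorm ltcR hN.
by move=> /cauchy_cvg /cvg_ex.
Qed.

Lemma bounded_operatorP (X : H -> H) :
  bounded_operator X <->
  linear X /\ exists2 M : R, 0 < M & forall u, rnorm (X u) <= M * rnorm u.
Proof.
split=> [[lX bX]|[lX [M M0 XM]]]; split=> //.
  pose XL := GRing.isLinear.Build _ _ _ _ _ lX.
  pose X' : {linear H -> H} := HB.pack X XL.
  have /linear_boundedP : bounded_near X' (nbhs (0 : H)) by [].
  move=> [r [rR hr]].
  (* The bound [r] is a real element of [R[i]]; a positive real strictly above it is needed. *)
  have [M M0 rM] : exists2 M : R, 0 < M & r < M%:C%C.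
    exists (`|complex.Re r| + 1); first by rewrite ltr_pwDr.
    rewrite -(RRe_real rR) ltcR; apply: le_lt_trans (ler_norm _) _.
    by rewrite ltrDl.
  exists M => // u.
  by have := hr _ rM u; rewrite /= !norm_rnorm -rmorphM lecR.
pose XL := GRing.isLinear.Build _ _ _ _ _ lX.
pose X' : {linear H -> H} := HB.pack X XL.
have : bounded_near X' (nbhs (0 : H)) => //.
apply/linear_boundedP; exists M%:C%C; split; first by rewrite realE lecR ltW.
move=> r Mr u; apply: (@le_trans _ _ (M%:C%C * `|u|)).
  by rewrite /= !norm_rnorm -rmorphM lecR.
by apply: ler_wpM2r => //; apply: ltW.
Qed.

End RealPart.

(** * Riesz representation *)

Section Adjoint.
Context {R : realType} {H : hilbertType R}.
Implicit Types (u v w z : H) (X Y G T S : H -> H).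

Section LinearFacts.
Variables (X : H -> H) (lX : linear X).
Lemma lin0 : X 0 = 0.
Proof. by have := lX (-1) 0 0; rewrite scaler0 addr0 scaleN1r addNr. Qed.
Lemma linD u v : X (u + v) = X u + X v.
Proof. by have := lX 1 u v; rewrite !scale1r. Qed.
Lemma linZ (c : R[i]) u : X (c *: u) = c *: X u.
Proof. by have := lX c u 0; rewrite lin0 !addr0. Qed.
Lemma linN u : X (- u) = - X u.
Proof. by rewrite -scaleN1r linZ scaleN1r. Qed.
End LinearFacts.

(* Minimise |G u|^2 / 2 - f u: by the parallelogram law the values G u of a
   minimising sequence are Cauchy, and their limit represents f. *)
Lemma riesz_range G (f : H -> R) (c : R) :
  linear G -> (forall u v, f (u + v) = f u + f v) ->
  (forall (r : R) u, f (r%:C%C *: u) = r * f u) ->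
  0 <= c -> (forall u, f u <= c * rnorm (G u)) ->
  exists w : H, [/\ forall u, rdot (G u) w = f u,
    forall z, (forall u, rdot (G u) z = 0) -> rdot w z = 0
    & rnorm w <= c].
Proof.
move=> lG fD fZ c0 fc.
pose J u := rdot (G u) (G u) - 2 * f u.
have JE u v (t : R) : J (u + t%:C%C *: v) =
    J u + 2 * t * (rdot (G u) (G v) - f v) + t ^+ 2 * rdot (G v) (G v).
  rewrite /J (linD _ lG) (linZ _ lG) fD fZ !rdotE (rdotC (G v) (G u)); ring.
have Jlb u : - c ^+ 2 <= J u.
  have := fc u; rewrite /J -rnorm_sqr; have := sqr_ge0 (rnorm (G u) - c).
  by move: (f u) (rnorm _) => x y; nra.
pose E : set R := range J.
have Einf : has_inf E.
  by split; [exists (J 0), 0|exists (- c ^+ 2) => _ [u _ <-]].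
have infJ u : inf E <= J u by apply: ge_inf; [case: Einf|exists u].
have minJ (n : nat) : exists u, J u < inf E + n.+1%:R^-1.
  have n0 : 0 < n.+1%:R^-1 :> R by rewrite invr_gt0.
  by have [_ [u _ <-] ?] := inf_adherent n0 Einf; exists u.
have [x xP] := choice minJ.
have small (e : R) : 0 < e -> exists N, forall n, (N <= n)%N -> n.+1%:R^-1 < e.
  move=> e0; exists (Num.truncn e^-1) => n Nn.
  rewrite -[e]invrK ltf_pV2 ?posrE ?invr_gt0 //.
  by apply: lt_le_trans (truncnS_gt _) _; rewrite ler_nat ltnS.
have [|w xw] := @rnorm_complete _ _ (fun n => G (x n)).
  move=> e e0; have [N hN] := small (e ^+ 2 / 4) (divr_gt0 (exprn_gt0 2 e0) (ltr0n _ 4)).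
  exists N => m n Nm Nn.
  (* Parallelogram law: eliminating the linear term between t = 1/2 and t = 1 gives |G(x n - x m)|^2
     / 4 <= (J(x m) + J(x n)) / 2 - inf E, which is below e^2 / 4. *)
  have h := JE (x m) (x n - x m) 2^-1.
  have hm := xP m; have hn := xP n; have sm := hN m Nm; have sn := hN n Nn.
  have h2 := infJ (x m + 2^-1%:C%C *: (x n - x m)).
  rewrite h in h2.
  have h3 := JE (x m) (x n - x m) 1.
  rewrite scale1r addrC subrK in h3.
  have -> : rnorm (G (x m) - G (x n)) = rnorm (G (x n - x m)).
    by rewrite -rnormN opprB (linD _ lG) (linN _ lG).
  rewrite -(@ltr_pXn2r _ 2) ?nnegrE ?rnorm_ge0 ?(ltW e0) // rnorm_sqr.
  move: (rdot (G (x n - x m)) _) (rdot _ _ - _) h2 h3 => a b.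
  move: hm hn sm sn; move: (J (x m)) (J (x n)) (inf E) => p q r.
  move: (m.+1%:R^-1) (n.+1%:R^-1) (e ^+ 2) => i j e2; clear -R.
  by rewrite expr1n expr2 => *; lra.
have orth u : rdot w (G u) - f u = 0.
  have quad (t : R) : 0 <= 2 * t * (rdot w (G u) - f u) + t ^+ 2 * rdot (G u) (G u).
    have c1 : n.+1%:R^-1 + (2 * t * (rdot (G (x n)) (G u) - f u)
        + t ^+ 2 * rdot (G u) (G u)) @[n --> \oo] -->
        0 + (2 * t * (rdot w (G u) - f u) + t ^+ 2 * rdot (G u) (G u)).
      apply: cvgD; first exact: cvg_harmonic.
      apply: cvgD; last exact: cvg_cst.
      apply: cvgMl_tmp; apply: cvgB; last exact: cvg_cst.
      exact: cvg_rdot.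
    rewrite add0r in c1.
    apply: ler_cvg_to (cvg_cst 0) c1 _; apply: nearW => n /=.
    have := infJ (x n + t%:C%C *: u); rewrite JE; have := xP n.
    move: (2 * t * _) (t ^+ 2 * _) (n.+1%:R^-1) (J _) (inf E) => a b i p q.
    by clear => *; lra.
  have := rdot_ge0 (G u); have := quad 1; have := quad (-1).
  move: (rdot (G u) (G u)) (rdot w _ - _) quad => a b quad h1 h2 h3.
  (* The minimiser would be -b/a; adding 1 to the denominator covers a = 0 and still makes the value
     a negative multiple of b^2. *)
  have := quad (- b / (a + 1)).
  have a0 : 0 < a + 1 by lra.
  rewrite -(pmulr_lge0 _ (exprn_gt0 2 a0)).
  rewrite (_ : (_ + _) * _ = - (b ^+ 2 * (a + 2))); last by field; rewrite gt_eqF.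
  move=> h; apply/eqP; rewrite -sqrf_eq0 eq_le sqr_ge0 andbT.
  by nra.
have wE u : rdot w (G u) = f u by apply/eqP; rewrite -subr_eq0 orth.
exists w; split.
- by move=> u; rewrite rdotC.
- move=> z hz; have := cvg_rdot _ _ z xw.
  rewrite (_ : (fun n => _) = cst 0); last by apply/funext => n; exact: hz.
  by move=> h; exact: (norm_cvg_unique h (cvg_cst _)).
(* As [w] is the limit of the vectors [G (x n)], this is the limit of <w, G(x n)> = f(x n) <= c |G(x
   n)|. *)
have : rdot w w <= c * rnorm w.
  have c1 := cvg_rdot _ _ w xw.
  have c2 : c * (rnorm w + rnorm (G (x n) - w)) @[n --> \oo] --> c * (rnorm w + 0).
    apply: cvgMl_tmp; apply: cvgD; first exact: cvg_cst.
    by apply/cvg_rnorm_sub.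
  rewrite addr0 in c2.
  apply: ler_cvg_to c1 c2 _; apply: nearW => n /=.
  rewrite rdotC wE; apply: le_trans (fc _) _; apply: ler_wpM2l => //.
  by have := ler_rnormD w (G (x n) - w); rewrite addrC subrK.
rewrite -rnorm_sqr expr2; have := rnorm_ge0 w; rewrite le0r => /orP[/eqP -> //|w0].
by rewrite ler_pM2r.
Qed.
End Adjoint.

(** * Adjoints and positive operators *)

Section Operators.
Context {R : realType} {H : hilbertType R}.
Implicit Types (u v w z : H) (X Y G T S A B : H -> H).

Lemma rdot_conjZ (c : R[i]) u v : rdot (c *: u) v = rdot u (conjc c *: v).
Proof.
rewrite /rdot linearZl_LR linearZr_LR /=.
by congr (complex.Re (_ * _)); rewrite -[RHS]/(conjc (conjc c)) conjcK.
Qed.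

Lemma rdot_Zconj (c : R[i]) u v : rdot u (c *: v) = rdot (conjc c *: u) v.
Proof. by rewrite rdotC rdot_conjZ rdotC. Qed.

Lemma rdot0l v : rdot 0 v = 0.
Proof. by rewrite /rdot linear0l. Qed.

(* For G = id, S is the adjoint of T; when |T u| = |G u|, it is the adjoint of
   the partial isometry sending G u to T u. *)
Lemma adjoint_factor G T (M : R) :
  linear G -> linear T -> 0 < M -> (forall u, rnorm (T u) <= M * rnorm (G u)) ->
  exists S, [/\ linear S, forall v, rnorm (S v) <= M * rnorm v,
    forall u v, rdot (G u) (S v) = rdot (T u) v
    & forall v z, (forall u, rdot (G u) z = 0) -> rdot (S v) z = 0].
Proof.
move=> lG lT M0 TG.
have ex v : exists w : H, [/\ forall u, rdot (G u) w = rdot (T u) v,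
    forall z, (forall u, rdot (G u) z = 0) -> rdot w z = 0
    & rnorm w <= M * rnorm v].
  apply: riesz_range => //.
  - by move=> x y; rewrite (linD _ lT) rdotDl.
  - by move=> r x; rewrite (linZ _ lT) rdotZl.
  - by rewrite mulr_ge0 ?rnorm_ge0 // ltW.
  move=> x; apply: le_trans (ler_rdot _ _) _.
  by rewrite mulrAC ler_wpM2r ?rnorm_ge0.
have [S SP] := choice ex.
have Sperp v z : (forall u, rdot (G u) z = 0) -> rdot (S v) z = 0.
  by case: (SP v) => _ + _; apply.
have GS u v : rdot (G u) (S v) = rdot (T u) v by case: (SP v) => + _ _; apply.
exists S; split => //; last by move=> v; case: (SP v).
move=> c x y; apply/eqP; rewrite -subr_eq0; apply/eqP.
set d := _ - _; apply: rdot_eq0.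
(* The linearity defect [d] is orthogonal to the range of [G], and so are its complex multiples
   since that range is a complex subspace. But [d] is a combination of values of [S], which are
   orthogonal to all such vectors. *)
have dG u : rdot (G u) d = 0.
  rewrite /d opprD !rdotDr !rdotNr !GS !rdotDr (rdot_Zconj c (G u)) -(linZ _ lG) GS.
  by rewrite (linZ _ lT) -rdot_Zconj; ring.
have dZ (e : R[i]) u : rdot (G u) (e *: d) = 0.
  by rewrite rdot_Zconj -(linZ _ lG) dG.
have dS a v : rdot (a *: S v) d = 0.
  by rewrite rdot_conjZ; apply: Sperp => u; exact: dZ.
rewrite {1}/d opprD !rdotDl !rdotNl dS -[S (_ + _)]scale1r -[S y]scale1r !dS.
by rewrite oppr0 !addr0.
Qed.

Lemma adjoint_exists X : bounded_operator X ->
  exists Y, bounded_operator Y /\ forall u v, '[X u, v] = '[u, Y v].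
Proof.
move=> /bounded_operatorP[lX [M M0 XM]].
have [S [lS SM XS _]] :=
  adjoint_factor id X M (fun _ _ _ => erefl) lX M0 XM.
exists S; split; first by apply/bounded_operatorP; split=> //; exists M.
move=> u v; apply: hdot_eq_rdot => //.
by rewrite -(linZ _ lX) XS.
Qed.

Lemma adjointP X : bounded_operator X ->
  bounded_operator (adjoint X) /\ forall u v, '[X u, v] = '[u, adjoint X v].
Proof.
move=> bX.
exact: (xgetPex (0 : H -> H) (adjoint_exists _ bX)).
Qed.

Lemma rdot_adjoint X u v : bounded_operator X ->
  rdot u (adjoint X v) = rdot (X u) v.
Proof. by move=> /adjointP[_ h]; rewrite /rdot h. Qed.

Lemma adjoint_unique X Y : bounded_operator X ->
  (forall u v, rdot (X u) v = rdot u (Y v)) -> adjoint X = Y.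
Proof.
move=> bX XY; apply/funext => v; apply: rdot_inj => w.
by rewrite rdotC rdot_adjoint // XY rdotC.
Qed.

Lemma conjci : conjc 'i%C = - 'i%C :> R[i].
Proof. by apply/eqP; rewrite eq_complex /= oppr0 !eqxx. Qed.

(** Nonnegativity in [R[i]] includes being real, that is, <A(iu), u> has zero real part; polarising
    this at iu + v gives symmetry. Conversely, symmetry makes the imaginary part of <Au, u> equal to
    its opposite. *)
Lemma positive_operatorP A :
  positive_operator A <-> [/\ bounded_operator A,
    forall u v, rdot (A u) v = rdot u (A v) & forall u, 0 <= rdot (A u) u].
Proof.
split=> [[bA A0]|[bA sA A0]].
  have lA := bA.1.
  have im u : rdot (A ('i%C *: u)) u = 0.
    have := A0 u; rewrite (linZ _ lA) rdot_imZl lecE => /andP[/eqP -> _].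
    by rewrite oppr0.
  split=> // [u v|u]; last by have := A0 u; rewrite lecE => /andP[].
  have := im ('i%C *: u + v); have := im ('i%C *: u); have := im v.
  rewrite scalerDr !(linD _ lA) !rdotE => -> ->.
  rewrite add0r addr0 scalerA -expr2 sqr_i scaleN1r (linN _ lA) rdotNl.
  rewrite (linZ _ lA) rdot_conjZ scalerA.
  rewrite conjci mulNr -expr2 sqr_i opprK.
  by rewrite scale1r addrC => /eqP; rewrite subr_eq0 (rdotC (A v)) => /eqP.
split=> // u; have lA := bA.1.
rewrite lecE A0 andbT -[_ == _]/(complex.Im '[A u, u] == 0).
rewrite -oppr_eq0 -rdot_imZl -(linZ _ lA).
have : rdot (A ('i%C *: u)) u = - rdot (A ('i%C *: u)) u.
  rewrite [LHS]sA [LHS]rdot_conjZ conjci scaleNr rdotNr -(linZ _ lA).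
  by rewrite (rdotC u).
by move=> h; apply/eqP; lra.
Qed.

Lemma rdot0r v : rdot v 0 = 0. Proof. by rewrite rdotC rdot0l. Qed.

Lemma positive_form_op A : positive_operator A ->
  positive_form (fun u v => rdot (A u) v).
Proof.
move=> /positive_operatorP[[lA _] sA A0]; split=> //.
- by move=> u v; rewrite sA rdotC.
- by move=> u v w; rewrite (linD _ lA) rdotDl.
- by move=> r u v; rewrite (linZ _ lA) rdotZl.
Qed.

Lemma bounded_form A : bounded_operator A ->
  exists2 c : R, 0 < c & forall u, rdot (A u) u <= c * rdot u u.
Proof.
move=> /bounded_operatorP[_ [M M0 AM]]; exists M => // u.
apply: le_trans (ler_rdot _ _) _.
by rewrite -rnorm_sqr expr2 mulrA ler_wpM2r ?rnorm_ge0.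
Qed.

Lemma bounded_operatorD X Y :
  bounded_operator X -> bounded_operator Y -> bounded_operator (X + Y).
Proof.
move=> /bounded_operatorP[lX [M M0 XM]] /bounded_operatorP[lY [N N0 YN]].
apply/bounded_operatorP; split.
  move=> c u v.
  by rewrite !fctE lX lY scalerDr addrACA.
exists (M + N); first exact: addr_gt0.
move=> u; rewrite fctE mulrDl; apply: le_trans (ler_rnormD _ _) _.
exact: lerD.
Qed.

Lemma bounded_operator_comp X Y :
  bounded_operator X -> bounded_operator Y -> bounded_operator (X \o Y).
Proof.
move=> /bounded_operatorP[lX [M M0 XM]] /bounded_operatorP[lY [N N0 YN]].
apply/bounded_operatorP; split; first by move=> c u v /=; rewrite lY lX.
exists (M * N); first exact: mulr_gt0.
by move=> u /=; apply: le_trans (XM _) _; rewrite -mulrA ler_pM2l.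
Qed.

Lemma positive_operatorD A B :
  positive_operator A -> positive_operator B -> positive_operator (A + B).
Proof.
move=> /positive_operatorP[bA sA A0] /positive_operatorP[bB sB B0].
apply/positive_operatorP; split; first exact: bounded_operatorD.
  by move=> u v; rewrite !fctE !rdotE sA sB.
by move=> u; rewrite fctE rdotDl addr_ge0.
Qed.

(** Put F = A - B. As A^2 = B^2, the operator (A + B)F + F(A + B) = 2(A^2 - B^2) vanishes, so F is
    skew for the form of A + B, and |Au| = |Bu| gives |Fu|^2 = 2 Re <AFu, u>. *)
Lemma positive_sqrt_unique A B : positive_operator A -> positive_operator B ->
  (forall u v, rdot (A u) (A v) = rdot (B u) (B v)) -> A = B.
Proof.
move=> pA pB AB.
have pG := positive_operatorD _ _ pA pB.
have [c c0 Gc] := bounded_form _ pG.1.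
have [bA sA A0] := (positive_operatorP A).1 pA.
have [bB sB B0] := (positive_operatorP B).1 pB.
have := @skew_form_eq0 _ _ _ _ rdot (fun u => A u - B u) c
  (positive_form_op _ pA) (positive_form_op _ pG) positive_rdot.
move=> /(_ _ c0 Gc) h; apply/funext => u; apply/eqP; rewrite -subr_eq0.
apply/eqP/rdot_eq0; apply: h => [v|v w|v].
- by rewrite fctE rdotDl lerDl.
- rewrite !fctE (linD _ bA.1) (linN _ bA.1) (linD _ bB.1) (linN _ bB.1).
  by rewrite !rdotE (sA (A v)) (sA (B v)) (sB (A v)) (sB (B v)) !AB; ring.
- rewrite (linD _ bA.1) (linN _ bA.1).
  by rewrite !rdotE (sA (A v)) (sA (B v)) AB (rdotC (A v) (B v)); lra.
Qed.

End Operators.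

(** * Existence of square roots *)

Section SquareRoot.
Context {R : realType} {H : hilbertType R}.
Implicit Types (u v w z : H) (X Y A B C : H -> H).

(* Iterates Y := (C + Y^2) / 2, whose fixed points satisfy (1 - Y)^2 = 1 - C;
   [sqrt_bound] is the scalar iteration for C = 1. *)
Fixpoint sqrt_iter C (n : nat) u : H :=
  if n is n'.+1 then
    2^-1%:C%C *: (C u + sqrt_iter C n' (sqrt_iter C n' u)) else 0.

Fixpoint sqrt_bound (n : nat) : R :=
  if n is n'.+1 then (1 + sqrt_bound n' ^+ 2) / 2 else 0.

Lemma sqrt_bound_itv n : 0 <= sqrt_bound n <= 1.
Proof.
elim: n => [|n /= /andP[]]; first by rewrite /= lexx ler01.
by move: (sqrt_bound n) => y y0 y1; apply/andP; split; nra.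
Qed.

Lemma sqrt_bound_nd : {homo sqrt_bound : m n / (m <= n)%N >-> m <= n}.
Proof.
apply/nondecreasing_seqP => n /=.
by have := sqr_ge0 (1 - sqrt_bound n); lra.
Qed.

Section Iter.
Variable C : H -> H.
Hypotheses (lC : linear C) (C1 : forall u, rnorm (C u) <= rnorm u).
Local Notation Y := (sqrt_iter C).
Local Notation y := sqrt_bound.

Lemma sqrt_iter_linear n : linear (Y n).
Proof.
elim: n => [|n IH] c u v; first by rewrite /= scaler0 addr0.
by rewrite /= lC !IH !scalerDr !scalerA (mulrC c) addrACA.
Qed.

Lemma rnorm_half (u : H) : rnorm (2^-1%:C%C *: u) = 2^-1 * rnorm u.
Proof. by rewrite rnormZ // invr_ge0. Qed.

Lemma sqrt_iter_bounded n u : rnorm (Y n u) <= y n * rnorm u.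
Proof.
elim: n u => [|n IH] u; first by rewrite /= /rnorm rdot0l sqrtr0 mul0r.
rewrite /= rnorm_half; have := ler_rnormD (C u) (Y n (Y n u)).
have /andP[y0 y1] := sqrt_bound_itv n.
have := IH (Y n u); have := ler_wpM2l y0 (IH u); have := C1 u.
move: (rnorm (Y n (Y n u))) (rnorm (Y n u)) (rnorm (C u)) (rnorm (_ + _)).
by move: (rnorm u) (y n) => a b *; nra.
Qed.

Lemma sqrt_iter_step n u :
  rnorm (Y n.+1 u - Y n u) <= (y n.+1 - y n) * rnorm u.
Proof.
elim: n u => [|n IH] u.
  by have := sqrt_iter_bounded 1 u; rewrite [Y 0 u]/= [y 0]/= !subr0.
(* With Z the iterate after Y, Z^2 - Y^2 = Z(Z - Y) + (Z - Y)Y holds without commutation, and the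
   same splitting of the scalar squares majorises it. *)
have -> : Y n.+2 u - Y n.+1 u = 2^-1%:C%C *:
    (Y n.+1 (Y n.+1 u - Y n u) + (Y n.+1 (Y n u) - Y n (Y n u))).
  rewrite -[Y n.+2 u]/(2^-1%:C%C *: (C u + Y n.+1 (Y n.+1 u))).
  rewrite -[X in _ - X = _]/(2^-1%:C%C *: (C u + Y n (Y n u))).
  rewrite -scalerBr; congr (_ *: _).
  rewrite (linD _ (sqrt_iter_linear n.+1)) (linN _ (sqrt_iter_linear n.+1)).
  by rewrite addrA subrK opprD addrACA subrr add0r.
have e2 : y n.+2 = (1 + y n.+1 ^+ 2) / 2 by [].
have e1 : y n.+1 = (1 + y n ^+ 2) / 2 by [].
have -> : y n.+2 - y n.+1 = (y n.+1 ^+ 2 - y n ^+ 2) / 2.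
  by rewrite e2 {2}e1; field.
rewrite rnorm_half.
have := ler_rnormD (Y n.+1 (Y n.+1 u - Y n u)) (Y n.+1 (Y n u) - Y n (Y n u)).
have /andP[y0 y1] := sqrt_bound_itv n.
have /andP[z0 z1] := sqrt_bound_itv n.+1.
have d0 : 0 <= y n.+1 - y n by rewrite subr_ge0 sqrt_bound_nd.
have h1 := sqrt_iter_bounded n.+1 (Y n.+1 u - Y n u).
have h2 := ler_wpM2l z0 (IH u).
have h3 := IH (Y n u).
have h4 := ler_wpM2l d0 (sqrt_iter_bounded n u).
move: h1 h2 h3 h4.
move: (rnorm (Y n.+1 (Y n.+1 u - Y n u))) (rnorm (Y n.+1 (Y n u) - _)).
move: (rnorm (Y n.+1 u - Y n u)) (rnorm (Y n u)) (rnorm u) (rnorm (_ + _)).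
by move: (y n.+1) (y n) y0 y1 z0 z1 d0 => *; nra.
Qed.

Lemma sqrt_iter_dist m n u : (n <= m)%N ->
  rnorm (Y m u - Y n u) <= (y m - y n) * rnorm u.
Proof.
move=> nm; rewrite -(subnKC nm); elim: (m - n)%N => [|k IH].
  by rewrite addn0 !subrr /rnorm rdot0l sqrtr0 mul0r.
rewrite addnS.
have -> : Y (n + k).+1 u - Y n u =
    (Y (n + k).+1 u - Y (n + k) u) + (Y (n + k) u - Y n u).
  by rewrite addrA subrK.
apply: le_trans (ler_rnormD _ _) _.
have := sqrt_iter_step (n + k) u; move: IH.
by move: (rnorm (_ - _)) (rnorm (_ - _)) => a b; lra.
Qed.

Lemma sqrt_iter_cvg u : exists l : H, Y ^~ u @ \oo --> l.
Proof.
apply: rnorm_complete => e e0.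
have ubd : has_ubound (range y).
  by exists 1 => _ [n _ <-]; case/andP: (sqrt_bound_itv n).
(* The scalar sequence is monotone and bounded, so beyond an index whose value is this close to the
   supremum its increments stay below this margin. The 1 covers u = 0. *)
have e'0 : 0 < e / (rnorm u + 1).
  by rewrite divr_gt0 // ltr_wpDl // rnorm_ge0.
have [_ [N _ <-] hN] := sup_adherent e'0 (conj (ex_intro _ _ (imageT y 0)) ubd).
exists N => m n Nm Nn.
wlog nm : m n Nm Nn / (n <= m)%N => [W|].
  case/orP: (leq_total n m) => h; first exact: W.
  by rewrite -rnormN opprB; exact: W.
apply: le_lt_trans (sqrt_iter_dist _ _ u nm) _.
have h1 : y N <= y n := sqrt_bound_nd _ _ Nn.
have h2 : y m <= sup (range y) by apply: ub_le_sup => //; exists m.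
have u0 := rnorm_ge0 u.
have : y m - y n < e / (rnorm u + 1) by lra.
have h3 : 0 < rnorm u + 1 by lra.
rewrite ltr_pdivlMr // => h4.
have : y n <= y m by exact: sqrt_bound_nd.
move: h4 u0 e0; move: (rnorm u) (y n) (y m) => a b d; nra.
Qed.

Hypothesis sC : forall u v, rdot (C u) v = rdot u (C v).

Lemma sqrt_iter_sym n u v : rdot (Y n u) v = rdot u (Y n v).
Proof.
elim: n u v => [|n IH] u v; first by rewrite /= rdot0l rdot0r.
by rewrite /= !rdotE sC !IH.
Qed.

(** The pointwise limit L satisfies 2L = C + L^2, so A = 1 - L squares to 1 - C; it is positive
    because L is a symmetric contraction. *)
Lemma sqrt_iter_limit : exists A, positive_operator A /\
  forall u, A (A u) = u - C u.
Proof.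
have [L LP] := choice sqrt_iter_cvg.
have lL : linear L.
  move=> c u v; apply: (norm_cvg_unique (LP _)).
  rewrite (_ : (fun n => _) = fun n => c *: Y n u + Y n v); last first.
    by apply/funext => n; exact: sqrt_iter_linear.
  by apply: cvgD (LP v); apply: cvgZl_tmp; exact: LP.
have L1 u : rnorm (L u) <= rnorm u.
  have h n : rdot (Y n u) (L u) <= rnorm u * rnorm (L u).
    apply: le_trans (ler_rdot _ _) _; apply: ler_wpM2r; first exact: rnorm_ge0.
    apply: le_trans (sqrt_iter_bounded n u) _.
    by rewrite ler_piMl ?rnorm_ge0 //; case/andP: (sqrt_bound_itv n).
  have : rdot (L u) (L u) <= rnorm u * rnorm (L u).
    apply: ler_cvg_to (cvg_rdot _ _ (L u) (LP u)) (cvg_cst _) _.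
    exact: nearW.
  have := rnorm_ge0 (L u); rewrite le0r => /orP[/eqP ->|l0].
    by rewrite rnorm_ge0.
  by rewrite -rnorm_sqr expr2 ler_pM2r.
have sL u v : rdot (L u) v = rdot u (L v).
  apply: (norm_cvg_unique (cvg_rdot _ _ v (LP u))).
  rewrite (rdotC u) (_ : (fun n => _) = fun n => rdot (Y n v) u).
    exact: cvg_rdot.
  by apply/funext => n; rewrite sqrt_iter_sym rdotC.
have LE u : L u = 2^-1%:C%C *: (C u + L (L u)).
  have c1 : Y n.+1 u @[n --> \oo] --> L u.
    by rewrite (cvg_shiftS (Y ^~ u)); exact: LP.
  apply: (norm_cvg_unique c1); rewrite /=.
  apply: cvgZl_tmp; apply: cvgD; first exact: cvg_cst.
  apply/cvg_rnorm_sub.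
  have c2 : rnorm (Y n u - L u) + rnorm (Y n (L u) - L (L u)) @[n --> \oo]
      --> (0 + 0 : R).
    by apply: cvgD; apply/cvg_rnorm_sub; exact: LP.
  rewrite addr0 in c2.
  apply: squeeze_cvgr (cvg_cst 0) c2; apply: nearW => n.
  rewrite rnorm_ge0 /=.
  (* Pointwise convergence passes to the composition because all iterates are contractions. *)
  have -> : Y n (Y n u) - L (L u) = Y n (Y n u - L u) + (Y n (L u) - L (L u)).
    by rewrite (linD _ (sqrt_iter_linear n)) (linN _ (sqrt_iter_linear n)) addrA subrK.
  apply: le_trans (ler_rnormD _ _) _; rewrite lerD2r.
  apply: le_trans (sqrt_iter_bounded _ _) _.
  by rewrite ler_piMl ?rnorm_ge0 //; case/andP: (sqrt_bound_itv n).
exists (fun u => u - L u); split.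
  apply/positive_operatorP; split.
  - apply/bounded_operatorP; split.
      by move=> c u v; rewrite lL scalerBr opprD addrACA.
    exists 2 => // u; apply: le_trans (ler_rnormD _ _) _.
    by rewrite rnormN; have := L1 u; lra.
  - by move=> u v; rewrite !rdotE sL.
  - move=> u; rewrite rdotDl rdotNl -rnorm_sqr subr_ge0.
    apply: le_trans (ler_rdot _ _) _.
    by rewrite expr2 ler_wpM2r ?rnorm_ge0.
move=> u; rewrite (linD _ lL) (linN _ lL).
have : L u + L u = C u + L (L u).
  rewrite {1 2}LE -scalerDl -rmorphD (_ : 2^-1 + 2^-1 = 1); last by field.
  by rewrite rmorph1 scale1r.
move=> h; have -> : C u = L u + L u - L (L u) by rewrite h addrK.
by rewrite -addrA -opprD addrA.
Qed.
End Iter.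
End SquareRoot.

(** * Absolute values and polar decomposition *)

Section AbsoluteValue.
Context {R : realType} {H : hilbertType R}.
Implicit Types (u v w z : H) (X Y A B C G T U : H -> H).

Lemma rnorm_le_rdot u v : (rnorm u <= rnorm v) = (rdot u u <= rdot v v).
Proof. by rewrite /rnorm ler_sqrt // rdot_ge0. Qed.

Lemma rnorm_le_adjoint X (M : R) : bounded_operator X ->
  (forall u, rnorm (X u) <= M * rnorm u) ->
  forall v, rnorm (adjoint X v) <= M * rnorm v.
Proof.
move=> bX XM v; have := rnorm_ge0 (adjoint X v).
rewrite le0r => /orP[/eqP a0|a0].
  rewrite a0; apply: le_trans (rnorm_ge0 _) (XM v).
rewrite -(ler_pM2r a0) -expr2 rnorm_sqr rdot_adjoint //.
apply: le_trans (ler_rdot _ _) _.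
by rewrite mulrAC ler_wpM2r ?rnorm_ge0.
Qed.

(** After scaling by k = 1/M^2, the operator C = 1 - k X^*X is a symmetric contraction, and M times
    the square root of 1 - C is the one sought. *)
Lemma positive_sqrt_exists X : bounded_operator X ->
  exists A, positive_operator A /\ A \o A = adjoint X \o X.
Proof.
move=> bX; have [lX [M M0 XM]] := (bounded_operatorP X).1 bX.
have [aX _] := adjointP _ bX; have lS := aX.1.
set S := adjoint X in aX lS *; pose k : R := M ^- 2.
have k0 : 0 < k by rewrite invr_gt0 exprn_gt0.
have SM := rnorm_le_adjoint _ _ bX XM.
pose C u := u - k%:C%C *: S (X u).
have CE u v : rdot (C u) v = rdot u v - k * rdot (X u) (X v).
  by rewrite !rdotE (rdotC (S _)) rdot_adjoint // (rdotC (X v)).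
have lC : linear C.
  move=> c u v; rewrite /C lX lS scalerDr scalerBr opprD addrACA.
  by rewrite !scalerA mulrC.
have sC u v : rdot (C u) v = rdot u (C v).
  by rewrite (rdotC u) !CE (rdotC u) (rdotC (X u)).
(* |Cu|^2 = |u|^2 - 2k |Xu|^2 + k^2 |X^*Xu|^2, and the choice of k gives k |X^*Xu|^2 <= |Xu|^2. *)
have C1 u : rnorm (C u) <= rnorm u.
  rewrite rnorm_le_rdot CE rdotC CE.
  have -> : rdot (X u) (X (C u)) = rdot (X u) (X u) - k * rdot (S (X u)) (S (X u)).
    rewrite rdotC -rdot_adjoint // CE rdot_adjoint //.
    by rewrite [rdot _ (X (S _))]rdotC -(rdot_adjoint X (S (X u))).
  have : k * rdot (S (X u)) (S (X u)) <= rdot (X u) (X u).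
    rewrite mulrC ler_pdivrMr ?exprn_gt0 // -!rnorm_sqr -exprMn mulrC.
    by rewrite lerXn2r ?nnegrE ?mulr_ge0 ?rnorm_ge0 // ltW.
  have := rdot_ge0 (X u); move: (rdot (X u) (X u)) => a; nra.
have [A [pA AA]] := sqrt_iter_limit C lC C1 sC.
have [bA sA A0] := (positive_operatorP A).1 pA; have lA := bA.1.
exists (fun u => M%:C%C *: A u); split.
  apply/positive_operatorP; split.
  - have [_ [N N0 AN]] := (bounded_operatorP A).1 bA.
    apply/bounded_operatorP; split.
      by move=> c u v; rewrite lA scalerDr !scalerA mulrC.
    exists (M * N) => [|u]; first exact: mulr_gt0.
    by rewrite rnormZ ?(ltW M0) // -mulrA ler_pM2l.
  - by move=> u v; rewrite !rdotE sA.
  - by move=> u; rewrite rdotZl mulr_ge0 // (ltW M0).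
apply/funext => u /=; rewrite (linZ _ lA) AA /C opprB addrC subrK !scalerA.
by rewrite -!rmorphM /k -expr2 divff ?rmorph1 ?scale1r // gt_eqF ?exprn_gt0.
Qed.

(** From here on absolute values are handled only through positivity and this identity of inner
    products, which together characterise them. *)
Lemma op_absP X : bounded_operator X -> positive_operator (op_abs X) /\
  forall u v, rdot (op_abs X u) (op_abs X v) = rdot (X u) (X v).
Proof.
move=> bX; have := xgetPex (0 : H -> H) (positive_sqrt_exists _ bX).
rewrite -/(op_abs X) => -[pA AA]; split=> // u v.
have [_ sA _] := (positive_operatorP _).1 pA.
by have /(congr1 (@^~ v)) /= AAv := AA; rewrite sA AAv rdot_adjoint.
Qed.

Lemma op_abs_unique X A : bounded_operator X -> positive_operator A ->
  (forall u v, rdot (A u) (A v) = rdot (X u) (X v)) -> op_abs X = A.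
Proof.
move=> /op_absP[pX Xabs] pA XA; apply: positive_sqrt_unique => // u v.
by rewrite XA Xabs.
Qed.

(** The adjoint S is built first, which avoids extending G u -> T u by continuity. Values of S and G
    lie in the double orthogonal complement of the range of G, so equalities between them need
    testing only against that range; this yields S T = G and S U S = S. *)
Lemma polar_decomposition G T : linear G -> linear T ->
  (forall u v, rdot (T u) (T v) = rdot (G u) (G v)) ->
  exists U, [/\ partial_isometry U, forall u, U (G u) = T u,
    forall v, rnorm (U v) <= rnorm v & forall v, rnorm (adjoint U v) <= rnorm v].
Proof.
move=> lG lT TG.
have TG1 u : rnorm (T u) <= 1 * rnorm (G u).
  by rewrite mul1r rnorm_le_rdot TG.
have [S [lS S1 GS Sperp]] := adjoint_factor G T 1 lG lT ltr01 TG1.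
have bS : bounded_operator S.
  by apply/bounded_operatorP; split=> //; exists 1.
have [bU _] := adjointP _ bS.
have US : adjoint (adjoint S) = S.
  apply: adjoint_unique => // u v.
  by rewrite rdotC rdot_adjoint // rdotC.
set U := adjoint S in bU US *.
have UE u v : rdot (U u) v = rdot u (S v).
  by rewrite rdotC rdot_adjoint // rdotC.
have ST u : S (T u) = G u.
  apply/eqP; rewrite -subr_eq0; apply/eqP/rdot_eq0.
  have h w : rdot (G w) (S (T u) - G u) = 0.
    by rewrite rdotDr rdotNr GS TG subrr.
  by rewrite {1}rdotDl rdotNl h Sperp ?subr0.
have SUS v : S (U (S v)) = S v.
  apply/eqP; rewrite -subr_eq0; apply/eqP/rdot_eq0.
  have h w : rdot (G w) (S (U (S v)) - S v) = 0.
    by rewrite rdotDr rdotNr !GS rdotC UE rdotC ST GS subrr.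
  by rewrite {1}rdotDl rdotNl !Sperp ?subr0.
have UU u v : rdot (S (U u)) v = rdot u (S (U v)).
  by rewrite -UE rdotC -UE rdotC.
exists U; split.
- split=> //; rewrite US; split.
  + exact: bounded_operator_comp.
  + by apply/funext => u /=; rewrite SUS.
  + by apply: adjoint_unique => //; exact: bounded_operator_comp.
- move=> u; apply: rdot_inj => v.
  by rewrite UE GS.
- move=> v; have := rnorm_le_adjoint S 1 bS S1 v.
  by rewrite mul1r.
- by move=> v; rewrite US; have := S1 v; rewrite mul1r.
Qed.

(** * The triangle equality *)

Lemma abs_triangle_factor X Y : bounded_operator X -> bounded_operator Y ->
  op_abs (X + Y) = op_abs X + op_abs Y ->
  exists U, [/\ partial_isometry U, X = U \o op_abs X & Y = U \o op_abs Y].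
Proof.
move=> bX bY absD.
have [pA AX] := op_absP _ bX; have [pB BY] := op_absP _ bY.
have [pG GT] := op_absP _ (bounded_operatorD _ _ bX bY).
rewrite absD in pG GT; set A := op_abs X in pA AX pG GT *.
set B := op_abs Y in pB BY pG GT *.
have [G GE] : exists G, forall u, G u = A u + B u by exists (A + B).
have [T TE] : exists T, forall u, T u = X u + Y u by exists (X + Y).
have EG : A + B = G by apply/funext => u; rewrite GE.
have ET : X + Y = T by apply/funext => u; rewrite TE.
have bT : bounded_operator T by rewrite -ET; exact: bounded_operatorD.
rewrite EG ET in pG GT.
have [bA sA A0] := (positive_operatorP A).1 pA.
have [bB sB B0] := (positive_operatorP B).1 pB.
have [bG sG G0] := (positive_operatorP _).1 pG.
have [c c0 Gc] := bounded_form _ bG.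
have [lA lX] := (bA.1, bX.1).
have [U [pU UG U1 S1]] := polar_decomposition _ _ bG.1 bT.1 (fun u v => esym (GT u v)).
have bU := pU.1; have lU := bU.1.
have UE u v : rdot (adjoint U u) v = rdot u (U v).
  by rewrite rdotC rdot_adjoint // rdotC.
pose F u := A u - adjoint U (X u).
have cross u v : rdot (A u) (B v) + rdot (B u) (A v) =
    rdot (X u) (Y v) + rdot (Y u) (X v).
  by have := GT u v; rewrite !GE !TE !rdotE AX BY; lra.
have F0 u : F u = 0.
  apply: rdot_eq0.
  apply: (skew_form_eq0 _ _ rdot F c (positive_form_op _ pA)
    (positive_form_op _ pG) positive_rdot _ c0 Gc) => [v|v w|v].
  - by rewrite GE rdotDl lerDl.
  (* Since U G = X + Y and <Av, Aw> = <Xv, Xw> in real parts, <Fv, Gw> reduces to <Av, Bw> - <Xv,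
     Yw>, and skewness is [cross]. *)
  - rewrite sG /F !rdotDl !rdotDr !rdotNl !rdotNr UE UG.
    rewrite (rdotC (G v)) (rdotC (G v)) UE UG !GE !TE !rdotE !(rdotC _ (A w)).
    rewrite !(rdotC _ (X w)) !AX.
    have := cross v w; rewrite !(rdotC _ (A w)) !(rdotC _ (X w)); lra.
  (* Expanding both sides, |Av - s|^2 <= 2 Re <Av, Av - s> amounts to |s| <= |Av|. *)
  have : rdot (adjoint U (X v)) (adjoint U (X v)) <= rdot (A v) (A v).
    by rewrite AX -rnorm_le_rdot.
  rewrite /F; set s := adjoint U (X v); rewrite (sA (A v - s)).
  rewrite !rdotDl !rdotDr !rdotNl !rdotNr (rdotC (A v) s).
  by move: (rdot (A v) (A v)) (rdot s (A v)) (rdot s s) => p q r; lra.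
have SX u : adjoint U (X u) = A u.
  by apply/eqP; rewrite eq_sym -subr_eq0 -/(F u) F0.
have XU u : X u = U (A u).
  apply/eqP; rewrite eq_sym -subr_eq0; apply/eqP/rdot_eq0/eqP.
  rewrite eq_le rdot_ge0 andbT.
  (* The cross term is <U^*Xu, Au> = |Au|^2 = |Xu|^2, so |UAu - Xu|^2 = |UAu|^2 - |Xu|^2, which is
     at most 0. *)
  rewrite !rdotDl !rdotDr !rdotNl !rdotNr (rdotC (U _) (X _)) -(UE (X u)) SX AX.
  have : rdot (U (A u)) (U (A u)) <= rdot (X u) (X u).
    by rewrite -AX -rnorm_le_rdot.
  by move: (rdot (U _) _) (rdot (X u) _) => p q; lra.
exists U; split=> //; first by apply/funext.
apply/funext => u; have := UG u; rewrite GE TE (linD _ lU) -XU.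
by move=> /addrI /=.
Qed.

(** U preserves the norm of each |X|u and |Y|u, so these lie in the range of the projection U^*U, on
    which U preserves inner products. Hence |X| + |Y| is positive and has the same inner products as
    X + Y = U(|X| + |Y|). *)
Lemma factor_abs_triangle X Y U : bounded_operator X -> bounded_operator Y ->
  partial_isometry U -> X = U \o op_abs X -> Y = U \o op_abs Y ->
  op_abs (X + Y) = op_abs X + op_abs Y.
Proof.
move=> bX bY [bU [bP PP _]] XU YU.
have [pA AX] := op_absP _ bX; have [pB BY] := op_absP _ bY.
have UE u v : rdot (adjoint U u) v = rdot u (U v).
  by rewrite rdotC rdot_adjoint // rdotC.
have lP := bP.1; set P := adjoint U \o U in bP PP lP.
have PE u v : rdot (P u) v = rdot (U u) (U v) by exact: UE.
(* For the projection P = U^*U, |Pw - w|^2 = |w|^2 - |Uw|^2. *)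
have fixed w : rdot (U w) (U w) = rdot w w -> P w = w.
  move=> h; apply/eqP; rewrite -subr_eq0; apply/eqP/rdot_eq0.
  rewrite !rdotDl !rdotDr !rdotNl !rdotNr (rdotC w) !PE.
  have -> : rdot (U w) (U (P w)) = rdot (U w) (U w).
    by rewrite rdotC -PE -[P (P w)]/((P \o P) w) PP PE.
  by rewrite h; lra.
have PA u : P (op_abs X u) = op_abs X u.
  by apply: fixed; rewrite AX {3 4}XU.
have PB u : P (op_abs Y u) = op_abs Y u.
  by apply: fixed; rewrite BY {3 4}YU.
apply: op_abs_unique; first exact: bounded_operatorD.
  exact: positive_operatorD.
move=> u v.
have XYE w : (X + Y) w = U ((op_abs X + op_abs Y) w).
  by rewrite !fctE (linD _ bU.1) {1}XU {1}YU.
rewrite !XYE -PE; congr (rdot _ _).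
by rewrite fctE (linD _ lP) PA PB.
Qed.

End AbsoluteValue.

Theorem theorem2p3 (R : realType) (H : hilbertType R)
    (infH : infinite_dimensional H) (X Y : H -> H)
    (bX : bounded_operator X) (bY : bounded_operator Y) :
  op_abs (X + Y) = op_abs X + op_abs Y <->
  exists U : H -> H,
    [/\ partial_isometry U, X = U \o op_abs X & Y = U \o op_abs Y].
Proof.
split=> [|[U [pU XU YU]]]; first exact: abs_triangle_factor.
exact: factor_abs_triangle pU XU YU.
Qed.
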